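(* Let $\mathbb G$ be an affine group scheme (of finite type over $k$) and consider two closed embeddings $\phi:\mathbb G\hookrightarrow GL_N$ and $\phi':\mathbb G\hookrightarrow GL_{N'}$. There exist positive integers $c,c'$ such that $$\mathcal O(\mathbb G)_{\leq d,\phi}\subset\mathcal O(\mathbb G)_{\leq c\cdot d,\phi'},\qquad \mathcal O(\mathbb G)_{\leq d,\phi'}\subset\mathcal O(\mathbb G)_{\leq c'\cdot d,\phi}$$ for all $d\geq 0$.
   Context: $k$ is a field of characteristic $p>0$. A closed embedding of affine group schemes is a closed immersion which is a morphism of group schemes. Let $\mathcal O(\mathbb M_{N,N})=k[x_{i,j};1\le i,j\le N]$ and let $\mathcal O(\mathbb M_{N,N})_{\leq d}$ be the polynomials of total degree $\leq d$. Let $\mathcal O(\mathbb G_m)=k[t,t^{-1}]$ with $\mathcal O(\mathbb G_m)_{\leq d}$ the span of $\{t^i: N\cdot|i|\leq d\}$, and give $\mathcal O(\mathbb M_{N,N})\otimes\mathcal O(\mathbb G_m)$ the total (tensor product) filtration. The closed immersion of monoid schemes $\eta:GL_N\hookrightarrow\mathbb M_{N,N}\times\mathbb G_m$, $A\mapsto(A,\det(A)^{-1})$, defines $\mathcal O(GL_N)_{\leq d}=\eta^*\big((\mathcal O(\mathbb M_{N,N})\otimes\mathcal O(\mathbb G_m))_{\leq d}\big)$; equivalently it is the span of elements $f\cdot\det^{i}$ with $i\in\mathbb Z$, $f\in\mathcal O(\mathbb M_{N,N})_{\leq a}$ and $a+N|i|\leq d$. For a closed embedding $\phi:\mathbb G\hookrightarrow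 GL_N$, set $\mathcal O(\mathbb G)_{\leq d,\phi}=\phi^*(\mathcal O(GL_N)_{\leq d})\subset\mathcal O(\mathbb G)$, a finite dimensional subcoalgebra. *)

(* Defs.v *)
From HB Require Import structures.
From mathcomp Require Import all_boot all_order all_algebra.
From mathcomp Require Import mpoly.
From mathcomp Require Import boolp classical_sets.

Set Implicit Arguments.
Unset Strict Implicit.
Unset Printing Implicit Defensive.

Import GRing.Theory.
Local Open Scope classical_set_scope.
Local Open Scope ring_scope.

Notation points A R := {lrmorphism A -> R}.

Definition push (k : fieldType) (A R S : comAlgType k)
    (u : {lrmorphism R -> S}) (g : points A R) : points A S :=
  (u \o g : {lrmorphism A -> S}).

Lemma lrmorphism_ext (k : fieldType) (A R : comAlgType k) (g h : points A R) :
  g =1 h -> g = h.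
Proof.
case: g h => [g [[cg1] [cg2] [cg3]]] [h [[ch1] [ch2] [ch3]]] /= E.
have e : g = h by apply: funext.
subst h.
by congr (GRing.LRMorphism.Pack (GRing.LRMorphism.Class _ _ _));
  congr (_ _); apply: Prop_irrelevance.
Qed.

(* An affine group scheme over k, given by its coordinate algebra O(G)
   together with a group structure on the functor of points
   R |-> G(R) = Hom_{k-alg}(O(G), R), natural in the commutative k-algebra R.
   By Yoneda this is the same datum as a commutative Hopf algebra structure
   on O(G).  Restricting to nonzero R, as comAlgType does, loses nothing:
   G(0) is a singleton, and O(G) is nonzero since G(k) contains a unit.
   Naturality of the unit and of the inverse follows from that of the
   product. *)
Record affGroupScheme (k : fieldType) := AffGroupScheme {
  coord : comAlgType k;
  pmul : forall R : comAlgType k,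
    points coord R -> points coord R -> points coord R;
  pone : forall R : comAlgType k, points coord R;
  pinv : forall R : comAlgType k, points coord R -> points coord R;
  pmulA : forall R : comAlgType k, associative (@pmul R);
  pmul1g : forall R : comAlgType k, left_id (pone R) (@pmul R);
  pmulVg : forall R : comAlgType k, left_inverse (pone R) (@pinv R) (@pmul R);
  pmul_natural : forall (R S : comAlgType k) (u : {lrmorphism R -> S})
      (g h : points coord R),
    push u (pmul g h) = pmul (push u g) (push u h)
}.

Definition finite_type (k : fieldType) (G : affGroupScheme k) : Prop :=
  exists (n : nat) (f : {lrmorphism {mpoly k[n]} -> coord G}),
    forall y : coord G, exists x, f x = y.

(* A morphism phi : G -> H, given by phi^* : O(H) -> O(G). *)
Record affGroupHom (k : fieldType) (G H : affGroupScheme k) := AffGroupHom {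
  comorph : {lrmorphism coord H -> coord G};
  comorphM : forall (R : comAlgType k) (g h : points (coord G) R),
    push (pmul g h) comorph = pmul (push g comorph) (push h comorph)
}.

(* A morphism of affine schemes is a closed immersion iff it is surjective on
   coordinate algebras. *)
Definition closed_embedding (k : fieldType) (G H : affGroupScheme k)
    (phi : affGroupHom G H) : Prop :=
  forall y : coord G, exists x : coord H, comorph phi x = y.

Definition kspan (k : fieldType) (V : lmodType k) (S : set V) : set V :=
  [set v | exists (n : nat) (c : 'I_n -> k) (s : 'I_n -> V),
    (forall i, S (s i)) /\ v = \sum_(i < n) c i *: s i].

Section GL.
Variables (k : fieldType) (N : nat).

(* O(M_{N,N}) = k[x_{i,j}], the pair (i, j) being encoded by mxvec_index. *)
Local Notation matpoly := {mpoly k[N * N]}.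

Definition genmx : 'M[matpoly]_N := \matrix_(i, j) 'X_(mxvec_index i j).

Definition detpoly : matpoly := \det genmx.

Section Eval.
Variable R : comAlgType k.

Definition mxeval (M : 'M[R]_N) : {rmorphism matpoly -> R} :=
  mmap (in_alg R) (fun i => mxvec M 0 i).

Lemma mxevalZ M (c : k) f : mxeval M (c *: f) = c *: mxeval M f.
Proof. by rewrite /mxeval /= mmapZ /= mulr_algl. Qed.

Lemma mxeval_gen M : map_mx (mxeval M) genmx = M.
Proof. by apply/matrixP => i j; rewrite !mxE /= mmapX mmap1U mxvecE. Qed.

Lemma mxeval_det M : mxeval M detpoly = \det M.
Proof. by rewrite /detpoly -det_map_mx mxeval_gen. Qed.
End Eval.

Lemma detpoly_neq0 : detpoly != 0.
Proof.
apply/eqP => d0; have := @mxeval_det (k^o : comAlgType k) 1%:M.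
by rewrite d0 rmorph0 det1 => /esym/eqP; rewrite oner_eq0.
Qed.

Local Notation F := {fraction matpoly}.

(* O(GL_N) = O(M_{N,N})[1/det], as a subring of the field of fractions. *)
Definition GLcoord_pred : {pred F} :=
  fun x => `[< exists (f : matpoly) (n : nat), x = tofrac f / tofrac detpoly ^+ n >].

Lemma GLcoord_predP x : reflect
  (exists (f : matpoly) (n : nat), x = tofrac f / tofrac detpoly ^+ n)
  (x \in GLcoord_pred).
Proof. exact: asboolP. Qed.

Lemma dF_neq0 n : tofrac detpoly ^+ n != 0 :> F.
Proof. by rewrite expf_neq0 // tofrac_eq0 detpoly_neq0. Qed.

Lemma GLcoord_subring : subring_closed GLcoord_pred.
Proof.
split.
- by apply/GLcoord_predP; exists 1, 0%N; rewrite rmorph1 expr0 divr1.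
- move=> _ _ /GLcoord_predP[f [m ->]] /GLcoord_predP[g [n ->]].
  apply/GLcoord_predP; exists (f * detpoly ^+ n - g * detpoly ^+ m), (m + n)%N.
  rewrite rmorphB !rmorphM !rmorphXn /= exprD.
  by rewrite -!mulNr addf_div ?dF_neq0.
- move=> _ _ /GLcoord_predP[f [m ->]] /GLcoord_predP[g [n ->]].
  apply/GLcoord_predP; exists (f * g), (m + n)%N.
  by rewrite rmorphM exprD mulf_div.
Qed.

HB.instance Definition _ :=
  GRing.isSubringClosed.Build F GLcoord_pred GLcoord_subring.

Record GLcoord := GLCoord { GLval : F; GLvalP : GLval \in GLcoord_pred }.

HB.instance Definition _ := [isSub for GLval].
HB.instance Definition _ := [Choice of GLcoord by <:].
HB.instance Definition _ := [SubChoice_isSubComNzRing of GLcoord by <:].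

Fact GLpoly_subproof (f : matpoly) : tofrac f \in GLcoord_pred.
Proof. by apply/GLcoord_predP; exists f, 0%N; rewrite expr0 divr1. Qed.

Definition GLpoly (f : matpoly) : GLcoord := GLCoord (GLpoly_subproof f).

Definition GLscale (c : k) (x : GLcoord) : GLcoord := GLpoly c%:MP * x.

Lemma GLscaleA a b x : GLscale a (GLscale b x) = GLscale (a * b) x.
Proof. by apply: val_inj; rewrite /= !rmorphM mulrA. Qed.
Lemma GLscale1 : left_id 1 GLscale.
Proof. by move=> x; apply: val_inj; rewrite /= !rmorph1 mul1r. Qed.
Lemma GLscaleDr : right_distributive GLscale +%R.
Proof. by move=> a x y; rewrite /GLscale mulrDr. Qed.
Lemma GLscaleDl v : {morph GLscale^~ v : a b / a + b}.
Proof. by move=> a b; apply: val_inj; rewrite /= !rmorphD mulrDl. Qed.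
HB.instance Definition _ := GRing.Zmodule_isLmodule.Build k GLcoord
  GLscaleA GLscale1 GLscaleDr GLscaleDl.
Lemma GLscaleAl (a : k) (x y : GLcoord) : a *: (x * y) = a *: x * y.
Proof. exact: mulrA. Qed.
HB.instance Definition _ := GRing.Lmodule_isLalgebra.Build k GLcoord GLscaleAl.
HB.instance Definition _ := GRing.Lalgebra_isComAlgebra.Build k GLcoord.


Fact GLcoord_rep (x : GLcoord) :
  exists fn : matpoly * nat, val x = tofrac fn.1 / tofrac detpoly ^+ fn.2.
Proof. by have /GLcoord_predP[f [n E]] := GLvalP x; exists (f, n). Qed.

(* The universal property of O(GL_N): matrices M, M' over R with M M' = 1 give
   a point x_{i,j} |-> M i j of GL_N(R). *)
Section Lift.
Variables (R : comAlgType k) (M M' : 'M[R]_N) (MM' : M *m M' = 1%:M).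

Definition GLlift_fun (x : GLcoord) : R :=
  let fn := sval (cid (GLcoord_rep x)) in
  mxeval M fn.1 * \det M' ^+ fn.2.

Lemma det_lift n : \det M ^+ n * \det M' ^+ n = 1.
Proof. by rewrite -exprMn -det_mulmx MM' det1 expr1n. Qed.

Lemma GLlift_funE x f n :
  val x = tofrac f / tofrac detpoly ^+ n ->
  GLlift_fun x = mxeval M f * \det M' ^+ n.
Proof.
rewrite /GLlift_fun; case: (cid _) => -[g m] /= -> /eqP.
rewrite eqr_div ?dF_neq0 // -!rmorphXn -!rmorphM /= tofrac_eq => /eqP E.
have := congr1 (mxeval M) E; rewrite !rmorphM !rmorphXn /= mxeval_det => E'.
by rewrite -[LHS]mulr1 -(det_lift n) mulrACA E' -mulrA [X in _ * X]mulrA det_lift mul1r.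
Qed.

Lemma GLlift_poly f : GLlift_fun (GLpoly f) = mxeval M f.
Proof.
by rewrite (@GLlift_funE _ f 0%N) ?expr0 ?mulr1 // divr1.
Qed.

Lemma GLlift_zmod : zmod_morphism GLlift_fun.
Proof.
move=> x y; have [[f m] /= Ex] := GLcoord_rep x; have [[g n] /= Ey] := GLcoord_rep y.
rewrite (GLlift_funE Ex) (GLlift_funE Ey).
rewrite (@GLlift_funE _ (f * detpoly ^+ n - g * detpoly ^+ m) (m + n)); last first.
  rewrite [LHS]/= Ex Ey rmorphB !rmorphM !rmorphXn exprD.
  by rewrite -!mulNr addf_div ?dF_neq0.
rewrite rmorphB !rmorphM !rmorphXn /= mxeval_det mulrBl exprD.
congr (_ - _); first by rewrite mulrACA det_lift mulr1.
by rewrite [_ ^+ m * _]mulrC mulrACA det_lift mulr1.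
Qed.

Lemma GLlift_monoid : monoid_morphism GLlift_fun.
Proof.
split=> [|x y].
  have -> : 1 = GLpoly 1 by apply: val_inj; rewrite /= rmorph1.
  by rewrite GLlift_poly rmorph1.
have [[f m] /= Ex] := GLcoord_rep x; have [[g n] /= Ey] := GLcoord_rep y.
rewrite (GLlift_funE Ex) (GLlift_funE Ey).
rewrite (@GLlift_funE _ (f * g) (m + n)).
  by rewrite rmorphM exprD mulrACA.
by rewrite rmorphM /= Ex Ey rmorphM exprD mulf_div.
Qed.

HB.instance Definition _ :=
  GRing.isZmodMorphism.Build GLcoord R GLlift_fun GLlift_zmod.
HB.instance Definition _ :=
  GRing.isMonoidMorphism.Build GLcoord R GLlift_fun GLlift_monoid.

Lemma GLlift_scalable : scalable GLlift_fun.
Proof.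
move=> c x; rewrite [c *: x]/(GLpoly c%:MP * x) rmorphM /= GLlift_poly.
by rewrite -[c%:MP]mulr1 mul_mpolyC mxevalZ rmorph1 mulr_algl.
Qed.

HB.instance Definition _ :=
  GRing.isScalable.Build k GLcoord R *:%R GLlift_fun GLlift_scalable.

Definition GLlift : points GLcoord R := GLlift_fun.
End Lift.

Lemma GLpoly_zmod : zmod_morphism GLpoly.
Proof. by move=> f g; apply: val_inj; rewrite /= rmorphB. Qed.
Lemma GLpoly_monoid : monoid_morphism GLpoly.
Proof.
by split=> [|f g]; apply: val_inj; rewrite /= ?rmorph1 ?rmorphM.
Qed.
HB.instance Definition _ :=
  GRing.isZmodMorphism.Build matpoly GLcoord GLpoly GLpoly_zmod.
HB.instance Definition _ :=
  GRing.isMonoidMorphism.Build matpoly GLcoord GLpoly GLpoly_monoid.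
Lemma GLpoly_scalable : scalable GLpoly.
Proof. by move=> c f; rewrite -mul_mpolyC rmorphM. Qed.
HB.instance Definition _ :=
  GRing.isScalable.Build k matpoly GLcoord *:%R GLpoly GLpoly_scalable.

Fact GLmono_subproof (f : matpoly) (i : int) :
  tofrac f * tofrac detpoly ^ i \in GLcoord_pred.
Proof.
apply/GLcoord_predP; case: i => n.
- by exists (f * detpoly ^+ n), 0%N; rewrite expr0 divr1 rmorphM rmorphXn.
- by exists f, n.+1; rewrite NegzE exprnN.
Qed.

Definition GLmono (f : matpoly) (i : int) : GLcoord :=
  GLCoord (GLmono_subproof f i).

Definition GLX : 'M[GLcoord]_N := map_mx GLpoly genmx.
Definition GLXinv : 'M[GLcoord]_N := GLmono 1 (-1) *: \adj GLX.

Lemma GLXK : GLX *m GLXinv = 1%:M.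
Proof.
rewrite /GLXinv -scalemxAr mul_mx_adj -mul_scalar_mx -scalar_mxM.
congr (_%:M); rewrite /GLX det_map_mx; apply: val_inj.
by rewrite /= rmorph1 mul1r mulVf // -[tofrac _]expr1 dF_neq0.
Qed.

Section Points.
Variable R : comAlgType k.
Implicit Types g h : points GLcoord R.

(* g |-> GLmx g identifies the points of GL over R with the invertible
   matrices over R (GLmx_inj, GLmxK, GLlift_mx). *)
Definition GLmx g : 'M[R]_N := map_mx g GLX.
Definition GLmxV g : 'M[R]_N := map_mx g GLXinv.

Lemma GLmxK g : GLmx g *m GLmxV g = 1%:M.
Proof. by rewrite -map_mxM GLXK map_mx1. Qed.

Lemma GLmxVK g : GLmxV g *m GLmx g = 1%:M.
Proof. exact/mulmx1C/GLmxK. Qed.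

Lemma GLlift_mx M M' (MM' : M *m M' = 1%:M) : GLmx (GLlift MM') = M.
Proof.
rewrite -[RHS]mxeval_gen /GLmx /GLX -map_mx_comp.
by apply: eq_map_mx => f; exact: GLlift_poly.
Qed.

Lemma point_poly g f : g (GLpoly f) = mxeval (GLmx g) f.
Proof.
elim/mpolyind: f => [|c m f _ _ IH]; first by rewrite !rmorph0.
rewrite [GLpoly _]raddfD !raddfD /= IH !linearZ mxevalZ; congr (_ *: _ + _).
rewrite mpolyXE_id !rmorph_prod; apply: eq_bigr => i _.
rewrite !rmorphXn; congr (_ ^+ _).
case/mxvec_indexP: i => i j.
by rewrite /= mmapX mmap1U mxvecE !mxE.
Qed.

Lemma GLmx_inj : injective GLmx.
Proof.
move=> g h E; apply: lrmorphism_ext => x.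
have [[f n] /= Ex] := GLcoord_rep x.
have Ex' : x * GLpoly detpoly ^+ n = GLpoly f.
  by apply: val_inj; rewrite rmorphM rmorphXn /= Ex divfK ?dF_neq0.
have := point_poly g f; rewrite E -point_poly -Ex' !rmorphM !rmorphXn /=.
rewrite !point_poly E mxeval_det => /(congr1 ( *%R^~ (\det (GLmxV h) ^+ n))).
by rewrite -!mulrA (det_lift (GLmxK h)) !mulr1.
Qed.

Lemma mulmxK2 g h : (GLmx g *m GLmx h) *m (GLmxV h *m GLmxV g) = 1%:M.
Proof. by rewrite mulmxA -(mulmxA (GLmx g)) GLmxK mulmx1 GLmxK. Qed.

Definition GLmul g h : points GLcoord R := GLlift (mulmxK2 g h).
Definition GLone : points GLcoord R := GLlift (mulmx1 (1%:M : 'M[R]_N)).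
Definition GLinv g : points GLcoord R := GLlift (GLmxVK g).

Lemma GLmx_mul g h : GLmx (GLmul g h) = GLmx g *m GLmx h.
Proof. exact: GLlift_mx. Qed.
Lemma GLmulA : associative GLmul.
Proof. by move=> g h l; apply: GLmx_inj; rewrite !GLlift_mx mulmxA. Qed.
Lemma GLmul1g : left_id GLone GLmul.
Proof. by move=> g; apply: GLmx_inj; rewrite !GLlift_mx mul1mx. Qed.
Lemma GLmulVg : left_inverse GLone GLinv GLmul.
Proof. by move=> g; apply: GLmx_inj; rewrite !GLlift_mx GLmxVK. Qed.
End Points.

Lemma GLmx_push (R S : comAlgType k) (u : {lrmorphism R -> S})
  (g : points GLcoord R) : GLmx (push u g) = map_mx u (GLmx g).
Proof. by apply/matrixP => i j; rewrite !mxE. Qed.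

Lemma GLmul_natural (R S : comAlgType k) (u : {lrmorphism R -> S})
    (g h : points GLcoord R) :
  push u (GLmul g h) = GLmul (push u g) (push u h).
Proof.
by apply: GLmx_inj; rewrite GLmx_push !GLlift_mx !GLmx_push map_mxM.
Qed.

Definition GL : affGroupScheme k :=
  AffGroupScheme GLmulA GLmul1g GLmulVg GLmul_natural.

(* O(GL_N)_{<= d}: f * det^i is eta^*(f (x) t^-i), and the tensor filtration in
   degree <= d is spanned by the f (x) t^i with deg f + N |i| <= d.
   msize f is 1 + deg f (and 0 for f = 0), so msize f <= a.+1 is deg f <= a. *)
Definition GLfilt (d : nat) : set (coord GL) :=
  kspan [set x | exists (f : matpoly) (i : int) (a : nat),
    [/\ (msize f <= a.+1)%N, (a + N * `|i| <= d)%N & x = GLmono f i]].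
End GL.

(* O(G)_{<= d, phi}. *)
Definition filt (k : fieldType) (G : affGroupScheme k) (N : nat)
    (phi : affGroupHom G (GL k N)) (d : nat) : set (coord G) :=
  comorph phi @` GLfilt d.

(* Main.v *)
Require Import Defs.
From mathcomp Require Import all_boot all_order all_algebra.
From mathcomp Require Import mpoly.
From mathcomp Require Import boolp classical_sets.
Import GRing.Theory.
Local Open Scope classical_set_scope.
Local Open Scope ring_scope.

Set Implicit Arguments.
Unset Strict Implicit.

(** The filtration of O(G) attached to an embedding phi is an exhaustive,
    increasing, multiplicative filtration by subspaces ([filt_exhaustive],
    [filt_leq], [filtM]).  Only finitely many elements, the coordinates x_{i,j}
    and det^{1}, det^{-1}, generate O(GL_N), so the images under phi^* of all of
    them lie in one step O(G)_{<= c, phi'} of the filtration attached to phi'.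
    An element f * det^i with deg f <= a and a + N|i| <= d is a linear
    combination of products of at most a + |i| generators, and |i| <= N|i| for N > 0, so
    multiplicativity puts its image in O(G)_{<= c * d, phi'} ([filt_sub]).
    For N = 0 the bound a + N|i| <= d does not control |i|, but then det = 1 and
    the factor det^i can be dropped.  The two inclusions follow by exchanging
    the roles of the embeddings. *)

Section Kspan.
Variables (k : fieldType) (V : lmodType k) (S : set V).

Lemma kspan_gen v : S v -> kspan S v.
Proof.
move=> Sv; exists 1%N, (fun=> 1), (fun=> v).
by split=> //; rewrite big_ord1 scale1r.
Qed.

Lemma kspan0 : kspan S 0.
Proof.
exists 0%N, (fun=> 0), (fun=> 0); split; first by case.
by rewrite big_ord0.
Qed.

Lemma kspanZ a v : kspan S v -> kspan S (a *: v).
Proof.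
move=> [n [c [s [Ss ->]]]]; exists n, (fun i => a * c i), s; split=> //.
by rewrite scaler_sumr; apply: eq_bigr => i _; rewrite scalerA.
Qed.

Lemma kspanD v w : kspan S v -> kspan S w -> kspan S (v + w).
Proof.
move=> [m [c [s [Ss ->]]]] [n [e [t [St ->]]]].
pose pick T (f : 'I_m -> T) (g : 'I_n -> T) i :=
  match split i with inl a => f a | inr b => g b end.
exists (m + n)%N, (pick k c e), (pick V s t); split=> [i|].
  by rewrite /pick; case: (split i).
rewrite big_split_ord /=; congr (_ + _); apply: eq_bigr => i _; rewrite /pick.
  by rewrite (unsplitK (inl i)).
by rewrite (unsplitK (inr i)).
Qed.

Lemma kspan_sum (I : Type) (r : seq I) (P : pred I) (F : I -> V) :
  (forall i, P i -> kspan S (F i)) -> kspan S (\sum_(i <- r | P i) F i).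
Proof. by apply: big_ind; [exact: kspan0 | exact: kspanD]. Qed.

End Kspan.

Section GLFiltration.
Variables (k : fieldType) (N : nat).
Implicit Types (x y : GLcoord k N) (f g : {mpoly k[N * N]}).

Lemma GLmonoM f g (i j : int) :
  GLmono f i * GLmono g j = GLmono (f * g) (i + j).
Proof.
apply: val_inj; rewrite rmorphM /= rmorphM mulrACA expfzDr //.
by rewrite -[tofrac _]expr1 dF_neq0.
Qed.

Lemma GLmono_poly f : GLmono f 0 = GLpoly f.
Proof. by apply: val_inj; rewrite /= expr0z mulr1. Qed.

Lemma GLmono_detX (b : int) n : GLmono 1 b ^+ n = GLmono 1 (b * n) :> GLcoord k N.
Proof.
elim: n => [|n IHn]; first by rewrite mulr0 GLmono_poly rmorph1.
by rewrite exprS IHn GLmonoM mulr1 -addn1 PoszD mulrDr mulr1 addrC.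
Qed.

Lemma GLfilt_leq d e x : (d <= e)%N -> GLfilt d x -> GLfilt e x.
Proof.
move=> le_de [n [c [s [Ss ->]]]]; exists n, c, s; split=> // i.
have [f [j [a [fa ad ->]]]] := Ss i.
by exists f, j, a; split=> //; exact: leq_trans ad le_de.
Qed.

Lemma GLfiltM d e x y : GLfilt d x -> GLfilt e y -> GLfilt (d + e) (x * y).
Proof.
move=> [m [c [s [Ss ->]]]] [n [b [t [St ->]]]].
rewrite mulr_suml; apply: kspan_sum => i _.
rewrite mulr_sumr; apply: kspan_sum => j _.
rewrite -scalerAl -scalerAr; apply/kspanZ/kspanZ/kspan_gen.
have [f [u [a [fa ad ->]]]] := Ss i; have [g [v [a' [ga' ae ->]]]] := St j.
exists (f * g), (u + v), (a + a')%N; split; last exact: GLmonoM.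
- have [->|f0] := eqVneq f 0; first by rewrite mul0r msize0.
  have [->|g0] := eqVneq g 0; first by rewrite mulr0 msize0.
  rewrite msizeM //; apply: (@leq_trans (a.+1 + a'.+1).-1).
    by rewrite -!subn1 leq_sub2r // leq_add.
  by rewrite addnS.
- apply: leq_trans (leq_add ad ae); rewrite addnACA leq_add2l -mulnDr.
  by rewrite leq_mul2l -lez_nat PoszD !abszE Num.Theory.ler_normD orbT.
Qed.

Lemma GLfilt_exhaustive x : exists d, GLfilt d x.
Proof.
have [[f n] /= Ex] := GLcoord_rep x.
exists (msize f + N * n)%N; apply: kspan_gen; exists f, (- n%:Z), (msize f).
split=> //; first by rewrite abszN.
by apply: val_inj; rewrite /= Ex exprnN.
Qed.

End GLFiltration.

Section Filtration.
Variables (k : fieldType) (G : affGroupScheme k) (N : nat).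
Variable phi : affGroupHom G (GL k N).
Implicit Types x y : Defs.coord G.

Lemma filt_leq d e x : (d <= e)%N -> filt phi d x -> filt phi e x.
Proof. by move=> le_de [z dz <-]; exists z => //; exact: GLfilt_leq le_de dz. Qed.

Lemma filt0 d : filt phi d 0.
Proof. by exists 0; [exact: kspan0 | rewrite raddf0]. Qed.

Lemma filt1 : filt phi 0 1.
Proof.
exists 1; last by rewrite rmorph1.
apply: kspan_gen; exists 1, 0, 0%N; split; rewrite ?muln0 ?msize1 //.
by rewrite GLmono_poly rmorph1.
Qed.

Lemma filtD d x y : filt phi d x -> filt phi d y -> filt phi d (x + y).
Proof.
move=> [z dz <-] [t dt <-]; exists (z + t); last by rewrite raddfD.
exact: kspanD.
Qed.

Lemma filtZ d (c : k) x : filt phi d x -> filt phi d (c *: x).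
Proof.
by move=> [z dz <-]; exists (c *: z); [exact: kspanZ | rewrite linearZ].
Qed.

Lemma filt_sum d (I : Type) (r : seq I) (P : pred I) (F : I -> Defs.coord G) :
  (forall i, P i -> filt phi d (F i)) -> filt phi d (\sum_(i <- r | P i) F i).
Proof. by apply: big_ind; [exact: filt0 | exact: filtD]. Qed.

Lemma filtM d e x y : filt phi d x -> filt phi e y -> filt phi (d + e) (x * y).
Proof.
move=> [z dz <-] [t et <-]; exists (z * t); last by rewrite rmorphM.
exact: GLfiltM.
Qed.

Lemma filtX d n x : filt phi d x -> filt phi (d * n) (x ^+ n).
Proof.
move=> dx; elim: n => [|n IHn]; first by rewrite muln0; exact: filt1.
by rewrite exprS mulnS; exact: filtM.
Qed.

Lemma filt_prod (I : Type) (r : seq I) (e : I -> nat) (F : I -> Defs.coord G) :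
  (forall i, filt phi (e i) (F i)) ->
  filt phi (\sum_(i <- r) e i) (\prod_(i <- r) F i).
Proof.
move=> eF; apply: (big_ind2 (fun n x => filt phi n x)) => //; first exact: filt1.
by move=> ? ? ? ?; exact: filtM.
Qed.

Lemma filt_exhaustive (hphi : closed_embedding phi) x : exists d, filt phi d x.
Proof.
have [z <-] := hphi x; have [d dz] := GLfilt_exhaustive z.
by exists d; exists z.
Qed.

(** A polynomial of degree at most [a] in elements of step [c] lies in step
    [c * a]. *)
Lemma filt_poly n (u : {lrmorphism {mpoly k[n]} -> Defs.coord G}) c a f :
  (forall j, filt phi c (u 'X_j)) -> (msize f <= a.+1)%N ->
  filt phi (c * a) (u f).
Proof.
move=> cu fa; rewrite [f]mpolyE raddf_sum big_seq; apply: filt_sum => m mf.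
rewrite /= linearZ; apply: filtZ; rewrite mpolyXE_id rmorph_prod.
have {mf} ma : (mdeg m <= a)%N by rewrite -ltnS (leq_trans (msize_mdeg_lt mf)).
apply: (@filt_leq (\sum_j c * m j)); last first.
  by apply: filt_prod => j; rewrite rmorphXn /=; exact: filtX (cu j).
by rewrite -big_distrr /= -mdegE leq_mul2l ma orbT.
Qed.

End Filtration.

(** Only the target embedding has to be closed: surjectivity of its comorphism
    makes the filtration attached to it exhaustive. *)
Lemma filt_sub (k : fieldType) (G : affGroupScheme k) (N N' : nat)
    (phi : affGroupHom G (GL k N)) (phi' : affGroupHom G (GL k N'))
    (hphi' : closed_embedding phi') :
  exists2 c : nat, (0 < c)%N & forall d, filt phi d `<=` filt phi' (c * d).
Proof.
pose u : {lrmorphism {mpoly k[N * N]} -> Defs.coord G} :=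
  comorph phi \o (@GLpoly k N : {lrmorphism _ -> Defs.coord (GL k N)}).
pose det (b : int) : Defs.coord G := comorph phi (GLmono 1 b).
have [e eX] := choice (fun j => filt_exhaustive hphi' (u 'X_j)).
have [ep epP] := filt_exhaustive hphi' (det 1).
have [en enP] := filt_exhaustive hphi' (det (-1)).
(* The successor makes [c] positive even when all generators are constants. *)
pose c := (\max_j e j + (ep + en)).+1.
have cX j : filt phi' c (u 'X_j).
  apply: filt_leq (eX j); apply: leqW.
  exact: leq_trans (leq_bigmax j) (leq_addr _ _).
have cp : filt phi' c (det 1).
  by apply: filt_leq epP; rewrite leqW // addnCA leq_addr.
have cn : filt phi' c (det (-1)).
  by apply: filt_leq enP; rewrite leqW // addnA leq_addl.
have cdet i : filt phi' (c * (N * `|i|)) (det i).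
  (* For N = 0 the claimed bound is 0, so det^i = 1 is really needed. *)
  have [N0|N_gt0] := posnP N.
    suff -> : det i = 1 by rewrite N0 muln0; exact: filt1.
    rewrite /det; suff -> : GLmono 1 i = 1 :> GLcoord k N by rewrite rmorph1.
    apply: val_inj; rewrite /= rmorph1 mul1r.
    suff -> : detpoly k N = 1 by rewrite rmorph1 exp1rz.
    by rewrite /detpoly; move: (Defs.genmx k N); rewrite N0 => M; exact: det_mx00.
  apply: (@filt_leq _ _ _ phi' (c * `|i|)).
    by rewrite leq_mul2l leq_pmull ?orbT.
  have [s [sP ->]] : exists s : int, filt phi' c (det s) /\ det i = det s ^+ `|i|.
    case: i => n; [exists 1 | exists (-1)]; split=> //.
      by rewrite /det -rmorphXn GLmono_detX mul1r.
    by rewrite /det -rmorphXn GLmono_detX mulN1r NegzE.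
  exact: filtX.
exists c => // d _ [_ [n [b [s [Ss ->]]]] <-].
rewrite raddf_sum; apply: filt_sum => i _; rewrite /= linearZ; apply: filtZ.
have [f [j [a [fa ad ->]]]] := Ss i.
have -> : GLmono f j = GLpoly f * GLmono 1 j :> GLcoord k N.
  by rewrite -GLmono_poly GLmonoM mulr1 add0r.
rewrite rmorphM; apply: (@filt_leq _ _ _ phi' (c * a + c * (N * `|j|))).
  by rewrite -mulnDr leq_mul2l ad orbT.
exact: filtM (filt_poly cX fa) (cdet j).
Qed.

Unset Implicit Arguments.
Set Strict Implicit.

Theorem proposition3p12 (k : fieldType) (p : nat) (hp : p \in [pchar k])
    (G : affGroupScheme k) (hG : finite_type G)
    (N N' : nat) (phi : affGroupHom G (GL k N)) (phi' : affGroupHom G (GL k N'))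
    (hphi : closed_embedding phi) (hphi' : closed_embedding phi') :
  exists c c' : nat, [/\ (0 < c)%N, (0 < c')%N &
    forall d : nat,
      filt phi d `<=` filt phi' (c * d) /\
      filt phi' d `<=` filt phi (c' * d)].
Proof.
have [c c0 hc] := filt_sub phi hphi'.
have [c' c'0 hc'] := filt_sub phi' hphi.
by exists c, c'; split.
Qed.
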